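(* Let $\mu^-<\mu^+$, $\Lambda=(\mu^-,\mu^+)$, $P=(p_{ij})\in\mathcal P_\mu$. Assume that $$\lim_{x\to+\infty}\vartheta(x,\mu^+)=+\infty$$ and that there exists $X>0$ such that $p_{11}(x)<\mu^-$ for all $x\ge X$. Then $\displaystyle\lim_{\lambda\to(\mu^+)^-}\nu(\lambda)=+\infty$.
   Context: $M^2_S$ is the set of real symmetric $2\times2$ matrices and $J=\begin{pmatrix}0&1\\-1&0\end{pmatrix}$. Class $\mathcal P_\mu$: continuous maps $P:(0,+\infty)\to M^2_S$ such that (i) there is $q_\infty\ge1$ with $\lim_{x\to+\infty}P(x)=P_\infty:=\mathrm{diag}(\mu^-,\mu^+)$ and $\int_1^{+\infty}\|P(x)-P_\infty\|^{q_\infty}dx<+\infty$; (ii) there are $\beta\ge1$, $P^*\in M^2_S$, $q_0\ge1$ with $\lim_{x\to0^+}x^\beta P(x)=P^*$ and $\int_0^1x^{-\beta}\|x^\beta P(x)-P^*\|^{q_0}dx<+\infty$; (iii) $\det P^*<-1/4$ if $\beta=1$, and $\det P^*<0$ if $\beta>1$. For $\lambda\in(\mu^-,\mu^+]$ let $\zeta_{1,\lambda}$ be the nontrivial solution (unique up to a constant factor) of $Jz'+P(x)z=\lambda z$, $x>0$, with $\zeta_{1,\lambda}(x)\to0$ as $x\to0^+$. Its continuous angular coordinate $\vartheta(\cdot,\lambda)$ (components $\rho\cos\vartheta$, $\rho\sin\vartheta$) has a finite limit at $0^+$, which mod $\pi$ does not depend on $\lambda$, and is normalized so that this limit lies in $[0,\pi)$.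 For $\lambda\in\Lambda$, the limit $\nu(\lambda)=\lim_{x\to+\infty}\vartheta(x,\lambda)$ exists and is finite. *)

(* Defs.v *)
From HB Require Import structures.
From mathcomp Require Import all_boot all_order all_algebra.
From mathcomp Require Import all_classical all_reals all_analysis.

Set Implicit Arguments.
Unset Strict Implicit.
Unset Printing Implicit Defensive.

Import Order.TTheory GRing.Theory Num.Theory.
Import numFieldTopology.Exports numFieldNormedType.Exports.

Local Open Scope classical_set_scope.
Local Open Scope ring_scope.

Section Dirac.
Variable R : realType.
Implicit Types (P : R -> 'M[R]_2) (A : 'M[R]_2) (z : R -> 'cV[R]_2).

Definition J : 'M[R]_2 := delta_mx 0 1 - delta_mx 1 0.

Definition Pinfty (mum mup : R) : 'M[R]_2 :=
  diag_mx (\row_(j < 2) if j == 0 then mum else mup).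

Definition symmetric_mx A : Prop := A^T = A.

(* Only the values of P on ]0, +oo[ matter. The norm on 'M[R]_2 is the sup
   norm of the entries; all norms being equivalent, finiteness of the integrals
   does not depend on this choice. *)
Definition condition_at_infty (mum mup : R) P : Prop :=
  exists qinf : R,
    [/\ 1 <= qinf,
        P x @[x --> +oo] --> Pinfty mum mup &
        (\int[lebesgue_measure]_(x in `[1%R, +oo[)
           (`|P x - Pinfty mum mup| `^ qinf)%:E < +oo)%E].

Definition condition_at_zero P : Prop :=
  exists (beta : R) (Pstar : 'M[R]_2) (q0 : R),
    [/\ [/\ 1 <= beta, symmetric_mx Pstar & 1 <= q0],
        (x `^ beta) *: P x @[x --> 0^'+] --> Pstar,
        (\int[lebesgue_measure]_(x in `]0%R, 1%R])
           (x `^ (- beta) * `|(x `^ beta) *: P x - Pstar| `^ q0)%:E < +oo)%E,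
        (beta = 1 -> \det Pstar < - 4^-1) &
        (1 < beta -> \det Pstar < 0)].

Definition class_P (mum mup : R) P : Prop :=
  [/\ forall x, 0 < x -> symmetric_mx (P x),
      forall x, 0 < x -> {for x, continuous P},
      condition_at_infty mum mup P &
      condition_at_zero P].

Definition is_solution P (lambda : R) z : Prop :=
  forall x, 0 < x ->
    derivable z x 1 /\ J *m 'D_1 z x + P x *m z x = lambda *: z x.

(* z is a possible choice of zeta_{1,lambda}, which is only determined up to a
   nonzero constant factor. *)
Definition is_zeta1 P (lambda : R) z : Prop :=
  [/\ is_solution P lambda z,
      exists2 x, 0 < x & z x != 0 &
      z x @[x --> 0^'+] --> (0 : 'cV[R]_2)].

Definition is_angular_coordinate z (th : R -> R) : Prop :=
  forall x, 0 < x ->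
    {for x, continuous th} /\
    exists rho : R,
      [/\ 0 < rho, z x 0 0 = rho * cos (th x) & z x 1 0 = rho * sin (th x)].

Definition normalized_at_zero (th : R -> R) : Prop :=
  exists l : R, 0 <= l < pi /\ th x @[x --> 0^'+] --> l.

End Dirac.

(* Main.v *)
(* In polar coordinates the equation reads th' = lambda - Q_x(th), where Q_x is
   the quadratic form of P x on the unit circle. At 0^+ the angle of a solution
   tends to a root l of the form of P^*; since the solution tends to 0, this is
   the root at which the form is increasing, hence it is the same for every
   lambda. Near (0, l) the flow is therefore contracting, so that th(x, lambda)
   depends continuously on lambda at mu^+ for each fixed x, in spite of the
   singularity at 0. Finally, for x >= X one has th' = lambda - p11 > 0 whenever
   th is a multiple of pi, so th(., lambda) never goes back below such a
   multiple: as th(., mu^+) exceeds any k pi at some x0 >= X, so does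
   th(x0, lambda) for lambda close to mu^+, and then nu(lambda) >= k pi. *)

Require Import Defs.
From HB Require Import structures.
From mathcomp Require Import all_boot all_order all_algebra.
From mathcomp Require Import all_classical all_reals all_analysis.
From mathcomp Require Import ring lra.

Import Order.TTheory GRing.Theory Num.Theory.
Import numFieldTopology.Exports numFieldNormedType.Exports.

Local Open Scope classical_set_scope.
Local Open Scope ring_scope.

Set Implicit Arguments.
Unset Strict Implicit.
Unset Printing Implicit Defensive.

(** * The quadratic form on the unit circle and its roots *)

(* The value of the form A at (cos t, sin t); qslope A (t + t) is its derivative
   in t. *)
Definition qform {R : realType} (A : 'M[R]_2) (t : R) : R :=
  A 0 0 * cos t ^+ 2 + 2 * A 0 1 * (sin t * cos t) + A 1 1 * sin t ^+ 2.

Definition qslope {R : realType} (A : 'M[R]_2) (u : R) : R :=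
  (A 1 1 - A 0 0) * sin u + 2 * A 0 1 * cos u.

(** In the double angle the form is a constant plus a sinusoid, so the sum-to-product formulas
    apply. Being exact, the identity turns the sign of the slope at [t + s] into monotonicity
    without any mean value argument. *)
Lemma qformB {R : realType} (A : 'M[R]_2) (t s : R) :
  qform A t - qform A s = sin (t - s) * qslope A (t + s).
Proof.
rewrite /qform /qslope sinB sinD cosD.
have := cos2Dsin2 t; have := cos2Dsin2 s.
move: (cos t) (sin t) (cos s) (sin s) => ct st cs ss Hs Ht.
have -> : cs ^+ 2 = 1 - ss ^+ 2 by lra.
have -> : ct ^+ 2 = 1 - st ^+ 2 by lra.
transitivity ((A 1 1 - A 0 0) * (st ^+ 2 * (cs ^+ 2 + ss ^+ 2)
   - (ct ^+ 2 + st ^+ 2) * ss ^+ 2) + 2 * A 0 1 *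
  (st * ct * (cs ^+ 2 + ss ^+ 2) - ss * cs * (ct ^+ 2 + st ^+ 2))); last by ring.
by rewrite Hs Ht; ring.
Qed.

Lemma qformZ {R : realType} (k : R) (A : 'M[R]_2) (t : R) :
  qform (k *: A) t = k * qform A t.
Proof. by rewrite /qform !mxE; ring. Qed.

Lemma qslopeZ {R : realType} (k : R) (A : 'M[R]_2) (u : R) :
  qslope (k *: A) u = k * qslope A u.
Proof. by rewrite /qslope !mxE; ring. Qed.

Lemma sym2E {R : realType} (A : 'M[R]_2) : symmetric_mx A -> A 1 0 = A 0 1.
Proof. by move=> sA; rewrite -[in LHS]sA mxE. Qed.

Lemma det_mx22 {R : comNzRingType} (A : 'M[R]_2) :
  \det A = A 0 0 * A 1 1 - A 0 1 * A 1 0.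
Proof.
rewrite (expand_det_row A 0) !big_ord_recl big_ord0 addr0 /cofactor !det_mx11.
rewrite !mxE /= expr0 expr1 mul1r mulN1r mulrN.
by do !congr (_ + _); try congr (- _); congr (A _ _ * A _ _); apply: val_inj.
Qed.

(** At [l + l], the slope and the sinusoid in quadrature with it have squares adding up to
    [(A 0 0 - A 1 1) ^+ 2 + 4 * A 0 1 ^+ 2]. At a root the second one is minus the trace, which
    leaves [- 4 * \det A] for the squared slope. *)
Lemma qslope_root_neq0 {R : realType} (A : 'M[R]_2) (l : R) :
  symmetric_mx A -> \det A < 0 -> qform A l = 0 -> qslope A (l + l) != 0.
Proof.
move=> /sym2E sA; rewrite det_mx22 sA => dA Ql0.
suff H : qslope A (l + l) ^+ 2 = - 4 * (A 0 0 * A 1 1 - A 0 1 * A 0 1).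
  by rewrite -sqrf_eq0 H; apply: lt0r_neq0; lra.
have W : (A 0 0 - A 1 1) * cos (l + l) + 2 * A 0 1 * sin (l + l) =
    - (A 0 0 + A 1 1).
  transitivity (2 * qform A l - (A 0 0 + A 1 1) * (cos l ^+ 2 + sin l ^+ 2)).
    by rewrite /qform sinD cosD; ring.
  by rewrite Ql0 cos2Dsin2; ring.
transitivity (((A 0 0 - A 1 1) ^+ 2 + 4 * A 0 1 ^+ 2) *
    (cos (l + l) ^+ 2 + sin (l + l) ^+ 2) -
    ((A 0 0 - A 1 1) * cos (l + l) + 2 * A 0 1 * sin (l + l)) ^+ 2).
  by rewrite /qslope; ring.
by rewrite W cos2Dsin2; ring.
Qed.

(* The slopes at two roots that are distinct mod pi are opposite. *)
Lemma qform_root_uniq {R : realType} (A : 'M[R]_2) (l1 l2 : R) :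
  0 <= l1 < pi -> 0 <= l2 < pi -> qform A l1 = 0 -> qform A l2 = 0 ->
  0 < qslope A (l1 + l1) -> 0 < qslope A (l2 + l2) -> l1 = l2.
Proof.
move=> h1 h2 Q1 Q2 S1 S2.
have E : sin (l1 - l2) * qslope A (l1 + l2) = 0 by rewrite -qformB Q1 Q2 subrr.
have [s0|] := eqVneq (sin (l1 - l2)) 0; last first.
  move=> sn0; move: E => /eqP; rewrite mulf_eq0 (negbTE sn0) /= => /eqP S0.
  (* The angles [l1 + l1] and [l2 + l2] are symmetric about [l1 + l2], a zero of the sinusoid, so
     the two slopes cancel and cannot both be positive. *)
  have : qslope A (l1 + l1) + qslope A (l2 + l2) =
         2 * cos (l1 - l2) * qslope A (l1 + l2).
    rewrite (_ : l1 + l1 = (l1 + l2) + (l1 - l2)); last by ring.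
    rewrite (_ : l2 + l2 = (l1 + l2) - (l1 - l2)); last by ring.
    move: (l1 + l2) (l1 - l2) => m d.
    by rewrite /qslope !sinD !cosD sinN cosN; ring.
  by rewrite S0 mulr0; lra.
have [l12|l12|//] := ltgtP l1 l2.
  have : 0 < sin (l2 - l1) by apply: sin_gt0_pi; lra.
  by rewrite -opprB sinN s0 oppr0 ltxx.
have : 0 < sin (l1 - l2) by apply: sin_gt0_pi; lra.
by rewrite s0 ltxx.
Qed.

(** * A barrier principle *)

(** Otherwise [f] vanishes at the infimum [s] of the points where it is nonpositive; being positive
    just before [s], it cannot have a positive derivative there. *)
Lemma barrier {R : realType} (f : R -> R) (a b : R) : a <= b ->
  (forall x, a <= x <= b ->
     exists2 d, is_derive x 1 f d & f x = 0 -> 0 < d) ->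
  0 < f a -> 0 < f b.
Proof.
move=> ab df fa0; rewrite ltNge; apply/negP => fb0.
pose E := [set x | a <= x <= b /\ f x <= 0].
have Eb : E b by split => //; rewrite ab lexx.
have hE : has_inf E.
  by split; [exists b|exists a => x [/andP[]]].
set s := inf E.
have as_ : a <= s by apply: lb_le_inf; [exists b|move=> x [/andP[]]].
have sb : s <= b by apply: ge_inf => //; exact: hE.2.
have sab : a <= s <= b by rewrite as_ sb.
have [d dfs fsd] := df _ sab.
have cf : {for s, continuous f}.
  by apply: differentiable_continuous; apply/derivable1_diffP.
have below y : a <= y -> y < s -> 0 < f y.
  move=> ay ys; rewrite ltNge; apply/negP => fy0.
  suff : s <= y by rewrite leNgt ys.
  by apply: ge_inf; [exact: hE.2|split=> //; rewrite ay (le_trans (ltW ys))].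
have fs0 : f s <= 0.
  rewrite leNgt; apply/negP => fs0.
  have : \forall y \near s, 0 < f y by exact: (cvgr_gt _ cf).
  move=> /nbhs_ballP[e /= e0 he].
  have [y Ey ys] := inf_adherent e0 hE.
  have sy : s <= y by apply: ge_inf => //; exact: hE.2.
  have := he y; rewrite /ball /= ltr_distlC => /(_ _); rewrite -/s in ys.
  have H : s - e < y < s + e by lra.
  by move=> /(_ H); case: Ey => _ /le_gtF ->.
have ltas : a < s.
  by rewrite lt_neqAle as_ andbT; apply: contraTneq fs0 => <-; rewrite -ltNge.
have fs0' : f s = 0.
  apply/eqP; rewrite eq_le fs0 /= leNgt; apply/negP => fsn.
  have : \forall y \near s, f y < 0 by exact: (cvgr_lt _ cf).
  move=> /nbhs_ballP[e /= e0 he].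
  pose y := Num.max a (s - e / 2).
  have ys : y < s by rewrite gt_max ltas /=; lra.
  have ye : s - e < y by rewrite lt_max; apply/orP; right; lra.
  have := below y; rewrite le_max lexx /= => /(_ isT ys) fy.
  have := he y; rewrite /ball /= ltr_distlC => /(_ _).
  have H : s - e < y < s + e by lra.
  by move=> /(_ H) /lt_gtF; rewrite fy.
have d0 := fsd fs0'.
have : derivable f s 1 by [].
rewrite /derivable => /cvg_ex[l hl].
have ld : l = d.
  by rewrite -(derive_val (is_derive := dfs)); symmetry; exact/cvg_lim.
rewrite {}ld in hl.
have : \forall h \near 0^', 0 < h^-1 *: ((f \o shift s) (h *: 1) - f s).
  exact: (cvgr_gt _ hl).
rewrite near_withinE /= => /nbhs_ballP[e /= e0 he].
(* A negative increment with [s + h] still in [[a, s[]: there [f] is positive, so the difference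
   quotient is negative. *)
pose h := Num.max (a - s) (- (e / 2)).
have h0 : h < 0 by rewrite gt_max; apply/andP; split; lra.
have ha : a - s <= h by rewrite le_max lexx.
have hb : - (e / 2) <= h by rewrite le_max lexx orbT.
have := he h; rewrite /ball /= sub0r normrN ltr0_norm // => /(_ _ _).
have H1 : - h < e by lra.
move=> /(_ H1 (ltr0_neq0 h0)).
rewrite fs0' subr0 [h *: 1]mulr1 /GRing.scale /= nmulr_rgt0 ?invr_lt0 //.
by apply/negP; rewrite -leNgt ltW // below //; lra.
Qed.

(** * The equation in polar coordinates *)

Lemma solution_is_derive {R : realType} (P : R -> 'M[R]_2) (lam : R)
    (z : R -> 'cV[R]_2) (x : R) : is_solution P lam z -> 0 < x ->
  is_derive x 1 (fun y => z y 0 0)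
    (P x 1 0 * z x 0 0 + (P x 1 1 - lam) * z x 1 0) /\
  is_derive x 1 (fun y => z y 1 0)
    ((lam - P x 0 0) * z x 0 0 - P x 0 1 * z x 1 0).
Proof.
move=> sol x0; have [dz eqz] := sol _ x0.
have dzij := (derivable_mxP _ _ _).1 dz.
move: eqz; rewrite derive_mx // => /matrixP eqz.
have o1 : lift 0 0 = 1 :> 'I_2 by exact: val_inj.
have := eqz 0 0; have := eqz 1 0.
rewrite !mxE !big_ord_recl !big_ord0 !mxE /= !o1 => e1 e0.
split; apply: DeriveDef => //.
  by move: e1; lra.
by move: e0; lra.
Qed.

(** The angle is only known to be continuous. Near [x], however, it equals
    [th x + atan (N y / D y)], where [D] and [N] are the components of [z y] in the frame rotated by
    [th x], and this expression is differentiable. *)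
Lemma angle_is_derive {R : realType} (P : R -> 'M[R]_2) (lam : R)
    (z : R -> 'cV[R]_2) (th : R -> R) (x : R) :
  is_solution P lam z -> is_angular_coordinate z th -> 0 < x ->
  symmetric_mx (P x) -> is_derive x 1 th (lam - qform (P x) (th x)).
Proof.
move=> sol ang x0 /sym2E sP.
have [cth [r [r0 zx0 zx1]]] := ang _ x0.
have [du dv] := solution_is_derive sol x0.
pose N y := cos (th x) * z y 1 0 - sin (th x) * z y 0 0.
pose D y := cos (th x) * z y 0 0 + sin (th x) * z y 1 0.
have Nx : N x = 0 by rewrite /N zx0 zx1; ring.
have Dx : D x = r.
  by rewrite /D zx0 zx1 -[RHS]mulr1 -(cos2Dsin2 (th x)); ring.
have rn0 : r != 0 by exact: lt0r_neq0.
have Dxn0 : D x != 0 by rewrite Dx.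
apply: (@near_eq_is_derive _ _ _ (fun y => th x + atan (N y * (D y)^-1))).
  have cpi : 0 < (pi : R) / 2 by rewrite divr_gt0 // pi_gt0.
  near=> y.
  have y0 : 0 < y by near: y; exact: lt_nbhsr.
  have yth : `|th x - th y| < pi / 2.
    by near: y; move/cvgrPdist_lt : cth; exact.
  have [_ [q [q0 zy0 zy1]]] := ang _ y0.
  have cn0 : cos (th y - th x) != 0.
    apply: lt0r_neq0; apply: cos_gt0_pihalf.
    by move: yth; rewrite distrC ltr_norml.
  rewrite (_ : _ * _ = tan (th y - th x)).
    rewrite tanK ?subrKC // in_itv /=.
    by move: yth; rewrite distrC ltr_norml.
  rewrite /N /D zy0 zy1 /tan sinB.
  have -> : cos (th x) * (q * cos (th y)) + sin (th x) * (q * sin (th y)) =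
    q * cos (th y - th x) by rewrite cosB; ring.
  field; rewrite cn0 /=; exact: lt0r_neq0.
have dN := is_deriveB (is_deriveZ (cos (th x)) dv) (is_deriveZ (sin (th x)) du).
have dD := is_deriveD (is_deriveZ (cos (th x)) du) (is_deriveZ (sin (th x)) dv).
have dVD := is_deriveV (f := D) Dxn0 dD.
have dND := is_deriveM (f := N) dN dVD.
have := is_derive1_comp (is_derive1_atan _) dND.
move=> /(is_deriveD (is_derive_cst (th x) x 1)) dF.
apply: is_derive_eq.
(* As [N x = 0], the derivative of [atan] is taken at 0, where it is 1, and the term with the
   derivative of [D] drops out. *)
have -> : (N * (fun y => (D y)^-1)) x = 0 by rewrite /GRing.mul /= Nx mul0r.
rewrite /GRing.scale /= Nx Dx zx0 zx1 sP /qform add0r expr0n /= addr0 invr1 mul1r.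
rewrite mul0r add0r.
transitivity (lam * (cos (th x) ^+ 2 + sin (th x) ^+ 2) -
   qform (P x) (th x)); last by rewrite cos2Dsin2 mulr1 /qform.
rewrite /qform; field; exact: rn0.
Unshelve. all: by end_near.
Qed.

Lemma normsq_is_derive {R : realType} (P : R -> 'M[R]_2) (lam : R)
    (z : R -> 'cV[R]_2) (th : R -> R) (x : R) :
  is_solution P lam z -> is_angular_coordinate z th -> 0 < x ->
  symmetric_mx (P x) ->
  is_derive x 1 (fun y => z y 0 0 ^+ 2 + z y 1 0 ^+ 2)
    ((z x 0 0 ^+ 2 + z x 1 0 ^+ 2) * qslope (P x) (th x + th x)).
Proof.
move=> sol ang x0 /sym2E sP.
have [_ [r [r0 zx0 zx1]]] := ang _ x0.
have [du dv] := solution_is_derive sol x0.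
apply: is_derive_eq.
rewrite /GRing.scale /= zx0 zx1 sP /qslope sinD cosD.
transitivity (r ^+ 2 * (cos (th x) ^+ 2 + sin (th x) ^+ 2) *
  ((P x 1 1 - P x 0 0) * (2 * sin (th x) * cos (th x)) +
    2 * P x 0 1 * (cos (th x) ^+ 2 - sin (th x) ^+ 2))); last by ring.
by rewrite cos2Dsin2; ring.
Qed.

(** * Limits along filters, in particular at 0 from the right *)

Lemma at_right0P {R : realType} (Q : R -> Prop) :
  (\forall x \near 0^'+, Q x) -> exists2 e, 0 < e & forall x, 0 < x < e -> Q x.
Proof.
move=> [e /= e0 he]; exists e => // x /andP[x0 xe].
by apply: he => //=; rewrite sub0r normrN gtr0_norm.
Qed.

Lemma cvg_mxij {R : realType} {T : Type} (F : set_system T) {FF : Filter F}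
    m n (A : T -> 'M[R]_(m, n)) (B : 'M[R]_(m, n)) i j :
  A x @[x --> F] --> B -> A x i j @[x --> F] --> B i j.
Proof. by move=> AB; exact: (@cvg_comp _ _ _ A (fun M => M i j) F _ _ AB (@coord_continuous _ _ _ i j B)). Qed.

Lemma cvg_sincos {R : realType} {T : Type} (F : set_system T) {FF : Filter F}
    (t : T -> R) (s : R) : t x @[x --> F] --> s ->
  sin (t x) @[x --> F] --> sin s /\ cos (t x) @[x --> F] --> cos s.
Proof.
move=> ts; split.
  exact: (cvg_comp _ _ ts (@continuous_sin _ s)).
exact: (cvg_comp _ _ ts (@continuous_cos _ s)).
Qed.

Lemma cvg_qform {R : realType} {T : Type} (F : set_system T) {FF : Filter F}
    (A : T -> 'M[R]_2) (t : T -> R) (B : 'M[R]_2) (s : R) :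
  A x @[x --> F] --> B -> t x @[x --> F] --> s ->
  qform (A x) (t x) @[x --> F] --> qform B s.
Proof.
move=> AB /cvg_sincos[ss cs].
have AijB i j : A x i j @[x --> F] --> B i j by exact: cvg_mxij.
apply: cvgD.
  apply: cvgD; first exact: cvgM (AijB 0 0) (cvgM cs cs).
  apply: cvgM; last exact: cvgM ss cs.
  by apply: cvgM (AijB 0 1); exact: cvg_cst.
exact: cvgM (AijB 1 1) (cvgM ss ss).
Qed.

Lemma cvg_qslope {R : realType} {T : Type} (F : set_system T) {FF : Filter F}
    (A : T -> 'M[R]_2) (t : T -> R) (B : 'M[R]_2) (s : R) :
  A x @[x --> F] --> B -> t x @[x --> F] --> s ->
  qslope (A x) (t x) @[x --> F] --> qslope B s.
Proof.
move=> AB /cvg_sincos[ss cs].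
have AijB i j : A x i j @[x --> F] --> B i j by exact: cvg_mxij.
apply: cvgD; first exact: cvgM (cvgB (AijB 1 1) (AijB 0 0)) ss.
apply: cvgM cs.
by apply: cvgM (AijB 0 1); exact: cvg_cst.
Qed.

(** * The limit angle at the singular endpoint *)

(** Since [beta] is at least 1, [x ^ beta] is at most [x] near 0 and erases [lam] in the limit: at
    leading order the angular equation at 0 is the same for all parameters. *)
Lemma scaled_field_cvg {R : realType} (P : R -> 'M[R]_2) (B : 'M[R]_2)
    (beta lam : R) (t : R -> R) (l : R) : 1 <= beta ->
  (x `^ beta) *: P x @[x --> 0^'+] --> B -> t x @[x --> 0^'+] --> l ->
  x `^ beta * (lam - qform (P x) (t x)) @[x --> 0^'+] --> - qform B l.
Proof.
move=> b1 PB tl.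
have xb0 : x `^ beta @[x --> 0^'+] --> (0 : R).
  apply: (@squeeze_cvgr _ _ _ _ (fun=> 0) id).
  - near=> x; rewrite powR_ge0 /= ge1r_powR //.
    by apply/andP; split; near: x; [exact: nbhs_right_gt|exact: nbhs_right_le].
  - exact: cvg_cst.
  - by apply: cvg_at_right_filter; exact: cvg_id.
rewrite (_ : (fun x => _) = (fun x => x `^ beta * lam - qform (x `^ beta *: P x) (t x))).
  rewrite -[X in _ --> X]add0r -[X in X - _](mul0r lam).
  apply: cvgB; last exact: cvg_qform.
  by apply: cvgM xb0 _; exact: cvg_cst.
by apply/funext => x; rewrite qformZ mulrBr.
Unshelve. all: by end_near.
Qed.

(* Otherwise |th'| >= c / x near 0, and th x - th (x / 2) does not tend to 0. *)
Lemma limit_angle_root {R : realType} (P : R -> 'M[R]_2) (B : 'M[R]_2)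
    (beta lam : R) (th : R -> R) (l : R) : 1 <= beta ->
  (x `^ beta) *: P x @[x --> 0^'+] --> B -> th x @[x --> 0^'+] --> l ->
  (forall x : R, 0 < x -> is_derive x 1 th (lam - qform (P x) (th x))) ->
  qform B l = 0.
Proof.
move=> b1 PB thl dth; apply/eqP; apply: contraT => q0.
set q := qform B l in q0.
have nq0 : 0 < `|q| by rewrite normr_gt0.
have gl := scaled_field_cvg lam b1 PB thl.
have /at_right0P[e e0 he] : \forall x \near (0 : R)^'+,
    [/\ `|q| / 2 < `|x `^ beta * (lam - qform (P x) (th x))|, x <= 1 &
      `|l - th x| < `|q| / 8].
  near=> x; split; near: x.
  - by apply: (cvgr_gt _ (cvg_norm gl)); rewrite normrN -/q; lra.
  - exact: nbhs_right_le.
  - by move/cvgrPdist_lt : thl; apply; lra.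
have e2 : 0 < e / 4 < e by lra.
have e1 : 0 < e / 2 < e by lra.
have [|||c] := @MVT _ th (fun x => lam - qform (P x) (th x)) (e / 4) (e / 2).
- by lra.
- by move=> x; rewrite in_itv /= => xe; apply: dth; lra.
- apply: derivable_within_continuous => x; rewrite in_itv /= => xe.
  by apply: (@ex_derive _ _ _ _ _ _ _ (dth x _)); lra.
rewrite in_itv /= => ce E.
have ce' : 0 < c < e by lra.
have [gc c1 _] := he _ ce'; have [_ _ h1] := he _ e1; have [_ _ h2] := he _ e2.
have : c `^ beta <= c by apply: ge1r_powR; lra.
rewrite normrM (ger0_norm (powR_ge0 _ _)) in gc.
set d := lam - _ in gc E => cb.
have A1 : c `^ beta * `|d| <= (e / 2) * `|d|.
  by apply: ler_wpM2r => //; lra.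
have A2 : `|th (e / 2) - th (e / 4)| = `|d| * (e / 4).
  by rewrite E normrM; congr (_ * _); rewrite ger0_norm; lra.
have : `|th (e / 2) - th (e / 4)| < `|q| / 4.
  rewrite (_ : _ - _ = (l - th (e / 4)) - (l - th (e / 2))); last by lra.
  by apply: le_lt_trans (ler_normB _ _) _; lra.
by rewrite A2; lra.
Unshelve. all: by end_near.
Qed.

(* The slope is the logarithmic derivative of |z|^2 (up to x^beta): were it
   negative, |z|^2 would be decreasing near 0 and could not tend to 0. *)
Lemma limit_slope_gt0 {R : realType} (P : R -> 'M[R]_2) (B : 'M[R]_2)
    (beta lam : R) (z : R -> 'cV[R]_2) (th : R -> R) (l : R) :
  (forall x : R, 0 < x -> symmetric_mx (P x)) -> symmetric_mx B -> \det B < 0 ->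
  (x `^ beta) *: P x @[x --> 0^'+] --> B -> th x @[x --> 0^'+] --> l ->
  is_solution P lam z -> is_angular_coordinate z th ->
  z x @[x --> 0^'+] --> (0 : 'cV[R]_2) ->
  qform B l = 0 -> 0 < qslope B (l + l).
Proof.
move=> sP sB dB PB thl sol ang z0 Q0.
have S0 := qslope_root_neq0 sB dB Q0.
rewrite lt_neqAle eq_sym S0 /= leNgt; apply/negP => Sn.
pose n x := z x 0 0 ^+ 2 + z x 1 0 ^+ 2.
have n_gt0 (x : R) : 0 < x -> 0 < n x.
  move=> x0; have [_ [r [r0 e1 e2]]] := ang _ x0.
  rewrite /n e1 e2 !exprMn -mulrDr cos2Dsin2 mulr1; exact: exprn_gt0.
have n0 : n x @[x --> 0^'+] --> (0 : R).
  have c i : z x i 0 @[x --> 0^'+] --> (0 : R).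
    have : z x i 0 @[x --> 0^'+] --> (0 : 'cV[R]_2) i 0 by exact: cvg_mxij.
    by rewrite mxE.
  rewrite -[X in _ --> X](addr0 0) -[X in _ --> X + _](mulr0 0) -[X in _ --> _ + X](mulr0 0).
  by apply: cvgD; apply: cvgM; exact: c.
have /at_right0P[e e0 he] : \forall x \near (0 : R)^'+, qslope (x `^ beta *: P x) (th x + th x) < 0.
  exact: (cvgr_lt _ (cvg_qslope PB (cvgD thl thl))).
have e1 : 0 < e / 2 by lra.
have /at_right0P[d d0 hd] : \forall x \near (0 : R)^'+, n x < n (e / 2).
  by apply: (cvgr_lt _ n0); exact: n_gt0.
(* Below [d], so that [n y < n (e / 2)], and below [e / 2], so that the decrease of [n] contradicts
   this. *)
pose y := Num.min (d / 2) (e / 4).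
have y0 : 0 < y by rewrite lt_min; apply/andP; split; lra.
have yd : y < d by rewrite gt_min; apply/orP; left; lra.
have ye : y < e / 2 by rewrite gt_min; apply/orP; right; lra.
have dn (x : R) : 0 < x -> is_derive x 1 n (n x * qslope (P x) (th x + th x)).
  by move=> x0; exact: (normsq_is_derive sol ang x0 (sP _ x0)).
have [||c] := @MVT _ n (fun x => n x * qslope (P x) (th x + th x)) y (e / 2) ye.
- by move=> x; rewrite in_itv /= => xe; apply: dn; lra.
- apply: derivable_within_continuous => x; rewrite in_itv /= => xe.
  by apply: (@ex_derive _ _ _ _ _ _ _ (dn x _)); lra.
rewrite in_itv /= => ce E.
have c0 : 0 < c by lra.
have ny := hd y; rewrite y0 yd in ny; have {}ny := ny isT.
have := he c; rewrite qslopeZ pmulr_rlt0 ?powR_gt0 // => /(_ _) Sc.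
have Sc' : qslope (P c) (th c + th c) < 0 by apply: Sc; lra.
have : n (e / 2) - n y < 0.
  by rewrite E pmulr_llt0 ?subr_gt0 // pmulr_rlt0 // n_gt0.
by lra.
Qed.

(** * An invariant funnel around the limit angle *)

(** Positivity of the slope at [(B, l + l)] is an open condition, and by [qformB] it gives the form
    of [B] strict opposite signs at [l + d] and [l - d]. Dividing by [x ^ beta] makes these values
    beat any fixed bounds [m] and [M] near 0. *)
Lemma funnel {R : realType} (P : R -> 'M[R]_2) (B : 'M[R]_2)
    (beta m M l : R) : 1 <= beta ->
  (x `^ beta) *: P x @[x --> 0^'+] --> B ->
  qform B l = 0 -> 0 < qslope B (l + l) ->
  exists d e, [/\ 0 < d, 0 < e, d + d < pi &
    forall x, 0 < x < e -> [/\ M < qform (P x) (l + d),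
      qform (P x) (l - d) < m &
      forall u, `|u - (l + l)| < d + d -> 0 < qslope (P x) u]].
Proof.
move=> b1 PB Q0 S0.
have : \forall p \near (nbhs B, nbhs (l + l)), 0 < qslope p.1 p.2.
  exact: (cvgr_gt _ (cvg_qslope (@cvg_fst _ _ (nbhs B) (nbhs (l + l)) _)
     (@cvg_snd _ _ (nbhs B) (nbhs (l + l)) _))).
move=> [[U V] /= [nU nV] UV].
move: nV => /nbhs_ballP[r /= r0 hr].
have pi0 := pi_gt0 R.
(* The first bound keeps [d + d] below the radius [r], the second gives [d + d < pi] and
   [0 < sin d]. *)
pose d := Num.min (r / 4) (pi / 4).
have d0 : 0 < d by rewrite lt_min; apply/andP; split; lra.
have dr : d <= r / 4 by rewrite ge_min lexx.
have dpi : d <= pi / 4 by rewrite ge_min lexx orbT.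
have pos A u : U A -> `|u - (l + l)| < d + d -> 0 < qslope A u.
  move=> UA ul; apply: (UV (A, u)); split => //=.
  by apply: hr; rewrite /ball /= distrC; lra.
have UB : U B by exact: nbhs_singleton.
have sd : 0 < sin d by apply: sin_gt0_pi; lra.
have Qp : 0 < qform B (l + d).
  have -> : qform B (l + d) = sin d * qslope B (l + d + l).
    by rewrite -[LHS]subr0 -[X in _ - X]Q0 qformB; congr (sin _ * _); lra.
  apply: mulr_gt0 => //; apply: pos => //.
  by rewrite [_ - _](_ : _ = d) ?gtr0_norm //; lra.
have Qm : qform B (l - d) < 0.
  have -> : qform B (l - d) = - (sin d * qslope B (l + (l - d))).
    by rewrite -[LHS]subr0 -[X in _ - X]Q0 -opprB qformB; congr (- (sin _ * _)); lra.
  rewrite oppr_lt0; apply: mulr_gt0 => //; apply: pos => //.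
  by rewrite [_ - _](_ : _ = - d) ?normrN ?gtr0_norm //; lra.
have /at_right0P[e e0 he] : \forall x \near (0 : R)^'+,
   [/\ x `^ beta * (M - qform (P x) (l + d)) < 0,
       0 < x `^ beta * (m - qform (P x) (l - d)) & U (x `^ beta *: P x)].
  near=> x; split; near: x; last exact: PB.
    apply: (cvgr_lt _ (scaled_field_cvg M b1 PB (@cvg_cst _ (l + d) _ _ _))).
    by rewrite oppr_lt0.
  apply: (cvgr_gt _ (scaled_field_cvg m b1 PB (@cvg_cst _ (l - d) _ _ _))).
  by rewrite oppr_gt0.
exists d, e; split => // [|x xe]; first by lra.
have xb : 0 < x `^ beta by apply: powR_gt0; lra.
have [h1 h2 Ux] := he _ xe; split.
- by rewrite -subr_lt0; rewrite pmulr_rlt0 in h1.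
- by rewrite -subr_gt0; rewrite pmulr_rgt0 in h2.
- move=> u ul; have := pos _ _ Ux ul.
  by rewrite qslopeZ pmulr_rgt0.
Unshelve. all: by end_near.
Qed.

(** The field [lam - qform] points inwards on both sides of the funnel, and the limit at 0 puts the
    angle inside at some earlier point [a]; [barrier] is applied to each side. *)
Lemma funnel_trap {R : realType} (P : R -> 'M[R]_2) (lam l d e : R)
    (th : R -> R) : 0 < d -> th x @[x --> 0^'+] --> l ->
  (forall x : R, 0 < x -> is_derive x 1 th (lam - qform (P x) (th x))) ->
  (forall x, 0 < x < e -> lam < qform (P x) (l + d)) ->
  (forall x, 0 < x < e -> qform (P x) (l - d) < lam) ->
  forall x, 0 < x < e -> `|th x - l| < d.
Proof.
move=> d0 thl dth hp hm x /andP[x0 xe].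
have /at_right0P[r r0 hr] : \forall y \near (0 : R)^'+, `|l - th y| < d.
  by move/cvgrPdist_lt : thl; exact.
pose a := Num.min (r / 2) x.
have a0 : 0 < a by rewrite lt_min x0 andbT; lra.
have ar : a < r by rewrite gt_min; apply/orP; left; lra.
have ax : a <= x by rewrite ge_min lexx orbT.
have : `|l - th a| < d by apply: hr; rewrite a0.
rewrite distrC ltr_distl => /andP[lo hi].
rewrite ltr_distl; apply/andP; split.
  rewrite -subr_gt0; apply: (@barrier _ (th - cst (l - d)) a x ax) => [y yax|]; last first.
    by rewrite !fctE; lra.
  have y0 : 0 < y by lra.
  exists (lam - qform (P y) (th y) - 0).
    exact: (is_deriveB (dth y y0) (is_derive_cst _ _ _)).
  rewrite !fctE => /eqP; rewrite subr_eq0 => /eqP ->.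
  by rewrite subr0 subr_gt0; apply: hm; lra.
rewrite -subr_gt0; apply: (@barrier _ (cst (l + d) - th) a x ax) => [y yax|]; last first.
  by rewrite !fctE; lra.
have y0 : 0 < y by lra.
exists (0 - (lam - qform (P y) (th y))).
  exact: (is_deriveB (is_derive_cst _ _ _) (dth y y0)).
rewrite !fctE => /eqP; rewrite subr_eq0 => /eqP <-.
by rewrite sub0r opprB subr_gt0; apply: hp; lra.
Qed.

(** * Dependence of the angle on the parameter *)

Lemma norm_sin_le {R : realType} (x : R) : `|sin x| <= `|x|.
Proof.
wlog x0 : x / 0 <= x.
  have [?|/ltW x0] := leP 0 x; first exact.
  by rewrite -[X in sin X]opprK sinN normrN -[leRHS]normrN; apply; rewrite oppr_ge0.
have [|c _] := @MVT_segment _ (@sin R) (@cos R) 0 x x0 (fun y _ => is_derive_sin y).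
  by apply: continuous_subspaceT; exact: continuous_sin.
by rewrite sin0 !subr0 => ->; rewrite normrM ler_piMl // cos_max.
Qed.

Lemma norm_qslope_le {R : realType} (A : 'M[R]_2) (u : R) :
  `|qslope A u| <= `|A 1 1| + `|A 0 0| + 2 * `|A 0 1|.
Proof.
apply: le_trans (ler_normD _ _) _; apply: lerD; rewrite !normrM.
  apply: le_trans (ler_normB _ _); rewrite ler_piMr //; exact: sin_max.
by rewrite (ger0_norm (ler0n _ 2)) ler_piMr ?mulr_ge0 //; exact: cos_max.
Qed.

Lemma qslope_bound {R : realType} (P : R -> 'M[R]_2) (a b : R) : a <= b ->
  (forall x, a <= x <= b -> {for x, continuous P}) ->
  exists K, forall x u, a <= x <= b -> `|qslope (P x) u| <= K.
Proof.
move=> ab cP.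
have [|c _ hc] := @EVT_max _ (fun x => `|P x 1 1| + `|P x 0 0| + 2 * `|P x 0 1|) a b ab.
  apply: continuous_in_subspaceT => x; rewrite inE /= in_itv /= => /cP cPx.
  have c i j : P y i j @[y --> x] --> P x i j by exact: cvg_mxij.
  apply: cvgD; first by apply: cvgD; apply: cvg_norm.
  by apply: cvgM; [exact: cvg_cst|exact: cvg_norm].
exists (`|P c 1 1| + `|P c 0 0| + 2 * `|P c 0 1|) => x u xab.
apply: le_trans (norm_qslope_le _ _) _; apply: hc; rewrite in_itv /=; exact: xab.
Qed.

(* th1 - th2 cannot cross the barrier - 2 (lam2 - lam1) exp ((|K| + 1) x): before
   e the form increases along the funnel, after e it is K-Lipschitz in the
   angle. *)
Lemma angle_comparison {R : realType} (P : R -> 'M[R]_2)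
    (l d e x0 K lam1 lam2 : R) (th1 th2 : R -> R) :
  lam1 < lam2 -> 0 < x0 ->
  (forall x : R, 0 < x -> is_derive x 1 th1 (lam1 - qform (P x) (th1 x))) ->
  (forall x : R, 0 < x -> is_derive x 1 th2 (lam2 - qform (P x) (th2 x))) ->
  th1 x @[x --> 0^'+] --> l -> th2 x @[x --> 0^'+] --> l ->
  (forall x, 0 < x < e -> `|th1 x - l| < d) ->
  (forall x, 0 < x < e -> `|th2 x - l| < d) ->
  d + d < pi ->
  (forall x u, 0 < x < e -> `|u - (l + l)| < d + d -> 0 < qslope (P x) u) ->
  (forall x u, e <= x <= x0 -> `|qslope (P x) u| <= K) ->
  th2 x0 - 2 * (lam2 - lam1) * expR ((`|K| + 1) * x0) < th1 x0.
Proof.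
move=> lam12 x00 dth1 dth2 th1l th2l h1 h2 dpi Spos SK.
set D := lam2 - lam1; set M := `|K| + 1.
have D0 : 0 < D by rewrite subr_gt0.
have K0 : 0 <= `|K| by [].
have E1 x : 0 < x -> 1 < expR (M * x) by move=> x_gt0; rewrite expR_gt1 mulr_gt0 // /M; lra.
pose E := expR \o (M \*: (@id R)).
have EE x : ((2 * D) \*: E) x = 2 * D * expR (M * x) by [].
have /at_right0P[r r0 hr] : \forall y \near (0 : R)^'+,
    `|l - th1 y| < D / 2 /\ `|l - th2 y| < D / 2.
  near=> y; split; near: y.
    by move/cvgrPdist_lt : th1l; apply; lra.
  by move/cvgrPdist_lt : th2l; apply; lra.
(* Starting point for [barrier]: both angles are within [D / 2] of [l] there, so their difference
   exceeds [- D]. *)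
pose a := Num.min (r / 2) x0.
have a0 : 0 < a by rewrite lt_min x00 andbT; lra.
have ar : a < r by rewrite gt_min; apply/orP; left; lra.
have ax : a <= x0 by rewrite ge_min lexx orbT.
suff : 0 < (th1 - th2 + (2 * D) \*: E) x0.
  by rewrite !fctE EE; lra.
apply: (@barrier _ _ a x0 ax) => [x xax|]; last first.
  have [] := hr a; first by rewrite a0.
  rewrite !ltr_norml => /andP[A1 A2] /andP[B1 B2].
  rewrite !fctE EE.
  have : 2 * D * 1 < 2 * D * expR (M * a) by rewrite ltr_pM2l ?E1 //; lra.
  by lra.
have x_gt0 : 0 < x by lra.
have dE : is_derive x 1 E (expR (M * x) * (M *: 1)).
  exact: (is_derive1_comp (is_derive_expR _) (is_deriveZ M (is_derive_id _ _))).
exists ((lam1 - qform (P x) (th1 x)) - (lam2 - qform (P x) (th2 x))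
     + (2 * D) *: (expR (M * x) * (M *: 1))).
  exact: (is_deriveD (is_deriveB (dth1 _ x_gt0) (dth2 _ x_gt0)) (is_deriveZ _ dE)).
rewrite !fctE EE /GRing.scale /= mulr1 => fx0.
have Ex1 := E1 _ x_gt0; set F := expR (M * x) in fx0 Ex1 *.
have DF : D < D * F by rewrite ltr_pMr.
have DFK : 0 <= D * F * `|K| by rewrite mulr_ge0 // ltW //; lra.
(* Because [D < D * F], it is enough to bound the difference of the two form values by
   [2 * (D * F * |K|)]. *)
have -> : lam1 - qform (P x) (th1 x) - (lam2 - qform (P x) (th2 x)) +
  2 * D * (F * M) = 2 * (D * F * `|K|) + 2 * (D * F) - D -
     (qform (P x) (th1 x) - qform (P x) (th2 x)) by rewrite /M /D; ring.
rewrite qformB.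
have wE : th1 x - th2 x = - (2 * (D * F)) by lra.
(* In the funnel the angle difference lies in []- pi, 0[] and the slope is positive, so the form
   difference is negative. Beyond [e], the bounds on [sin] and on the slope apply. *)
have [xe|ex] := ltP x e.
  have xe' : 0 < x < e by rewrite x_gt0.
  have := h1 _ xe'; have := h2 _ xe'.
  rewrite !ltr_norml => /andP[A1 A2] /andP[B1 B2].
  have Sp : 0 < qslope (P x) (th1 x + th2 x).
    by apply: Spos => //; rewrite ltr_norml; apply/andP; split; lra.
  have sn : sin (th1 x - th2 x) < 0.
    by rewrite -oppr_gt0 -sinN; apply: sin_gt0_pi; lra.
  have : sin (th1 x - th2 x) * qslope (P x) (th1 x + th2 x) < 0.
    by rewrite nmulr_rlt0.
  by lra.
have : sin (th1 x - th2 x) * qslope (P x) (th1 x + th2 x) <= 2 * (D * F * `|K|).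
  apply: le_trans (ler_norm _) _; rewrite normrM.
  rewrite -mulrA mulrA [leRHS]mulrA; apply: ler_pM => //.
    apply: le_trans (norm_sin_le _) _.
    by rewrite wE normrN ger0_norm //; lra.
  by apply: le_trans (ler_norm K); apply: SK; lra.
by lra.
Unshelve. all: by end_near.
Qed.

(** * Multiples of pi, and the limit of [nu] *)

Lemma sin_natpi {R : realType} (k : nat) : sin (pi *+ k : R) = 0.
Proof. by elim: k => [|k IH]; rewrite ?mulr0n ?sin0 // mulrS addrC sinDpi IH oppr0. Qed.

Lemma qform_natpi {R : realType} (A : 'M[R]_2) (k : nat) : qform A (pi *+ k) = A 0 0.
Proof.
have s0 := @sin_natpi R k.
by rewrite /qform cos2sin2 s0; ring.
Qed.

(* At a zero of [sin th] one has [th' = lam - P x 0 0 > 0], so [th] cannot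
   cross a multiple of [pi] downwards. *)
Lemma angle_above_natpi {R : realType} (P : R -> 'M[R]_2) (lam X x0 : R)
    (th : R -> R) (k : nat) :
  (forall x : R, 0 < x -> is_derive x 1 th (lam - qform (P x) (th x))) ->
  (forall x, X <= x -> P x 0 0 < lam) -> 0 < x0 -> X <= x0 ->
  pi *+ k < th x0 -> forall x, x0 <= x -> pi *+ k < th x.
Proof.
move=> dth hP x00 Xx0 hx0 x xx0.
rewrite -subr_gt0; apply: (@barrier _ (th - cst (pi *+ k)) x0 x xx0) => [y yx|]; last first.
  by rewrite !fctE subr_gt0.
have y0 : 0 < y by lra.
exists (lam - qform (P y) (th y) - 0).
  exact: (is_deriveB (dth y y0) (is_derive_cst _ _ _)).
rewrite !fctE => /eqP; rewrite subr_eq0 => /eqP ->.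
by rewrite qform_natpi subr0 subr_gt0; apply: hP; lra.
Qed.

Theorem lemma3p8 (R : realType) (mum mup : R) (P : R -> 'M[R]_2)
  (zeta : R -> R -> 'cV[R]_2) (theta : R -> R -> R) (nu : R -> R)
  (hmu : mum < mup)
  (hP : class_P mum mup P)
  (hzeta : forall lambda, mum < lambda <= mup ->
     is_zeta1 P lambda (fun x => zeta x lambda))
  (htheta : forall lambda, mum < lambda <= mup ->
     is_angular_coordinate (fun x => zeta x lambda) (fun x => theta x lambda))
  (htheta0 : forall lambda, mum < lambda <= mup ->
     normalized_at_zero (fun x => theta x lambda))
  (hnu : forall lambda, mum < lambda < mup ->
     theta x lambda @[x --> +oo] --> nu lambda)
  (hmup : theta x mup @[x --> +oo] --> +oo)
  (hp11 : exists X : R, 0 < X /\ forall x, X <= x -> P x 0 0 < mum) :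
  nu lambda @[lambda --> mup^'-] --> +oo.
Proof.
have [sP cP _ [beta [B [q0 [[b1 sB _] PB _ dB1 dB2]]]]] := hP.
have dB : \det B < 0.
  have [b1'|b1'|b1'] := ltgtP 1 beta; [exact: dB2| by lra|].
  by apply: lt_trans (dB1 (esym b1')) _; rewrite oppr_lt0 invr_gt0.
have mupI : mum < mup <= mup by rewrite hmu lexx.
have ode lam : mum < lam <= mup -> forall x : R, 0 < x ->
    is_derive x 1 (fun y => theta y lam) (lam - qform (P x) (theta x lam)).
  move=> lamI x x0; have [sol _ _] := hzeta _ lamI.
  exact: (angle_is_derive sol (htheta _ lamI) x0 (sP _ x0)).
have limit lam : mum < lam <= mup -> exists l, [/\ 0 <= l < pi,
    theta x lam @[x --> 0^'+] --> l, qform B l = 0 & 0 < qslope B (l + l)].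
  move=> lamI; have [sol _ z0] := hzeta _ lamI; have [l [lpi thl]] := htheta0 _ lamI.
  have Q0 := limit_angle_root b1 PB thl (ode _ lamI).
  exists l; split=> //.
  exact: (limit_slope_gt0 sP sB dB PB thl sol (htheta _ lamI) z0 Q0).
have [l [lpi thl Q0 S0]] := limit _ mupI.
have {}limit lam : mum < lam <= mup -> theta x lam @[x --> 0^'+] --> l.
  move=> lamI; have [l' [l'pi thl' Q0' S0']] := limit _ lamI.
  by rewrite (qform_root_uniq lpi l'pi Q0 Q0' S0 S0').
(* With bounds [mum] and [mup], one funnel serves all parameters, so [e], [x0] and [K] are fixed
   before [lam]. *)
have [d [e [d0 e0 dpi fun_e]]] := funnel mum mup b1 PB Q0 S0.
have trap lam : mum < lam <= mup ->
    forall x, 0 < x < e -> `|theta x lam - l| < d.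
  move=> lamI; apply: (funnel_trap d0 (limit _ lamI) (ode _ lamI)) => x /fun_e[].
    by move=> ? _ _; lra.
  by move=> _ ? _; lra.
have [X [X0 hX]] := hp11.
apply/cvgryPge => A.
have [k Ak] : exists k, A <= pi *+ k.
  exists (Num.bound (`|A| / pi)); apply: le_trans (ler_norm A) _.
  rewrite -mulr_natl -ler_pdivrMr ?pi_gt0 //; apply/ltW/archi_boundP.
  by rewrite divr_ge0 // pi_ge0.
(* The extra 1 is the margin spent in passing from [mup] to [lam]. *)
have [x0 [x0X x0e x0k]] : exists x0, [/\ X <= x0, e <= x0 & pi *+ k + 1 < theta x0 mup].
  near (pinfty_nbhs R) => x0; exists x0; split; near: x0.
  - apply: nbhs_pinfty_ge; exact: num_real.
  - apply: nbhs_pinfty_ge; exact: num_real.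
  - by move/cvgryPgt : hmup; exact.
have x00 : 0 < x0 by lra.
have [K SK] : exists K, forall x u, e <= x <= x0 -> `|qslope (P x) u| <= K.
  by apply: qslope_bound => // x xe; apply: cP; lra.
(* The loss in [angle_comparison] is [C * (mup - lam)], below 1 once [lam] is within [C^-1] of
   [mup]. *)
set C := 2 * expR ((`|K| + 1) * x0).
have C0 : 0 < C by rewrite mulr_gt0 // expR_gt0.
near=> lam.
have lam_mup : lam < mup by near: lam; exact: nbhs_left_lt.
have mum_lam : mum < lam by near: lam; exact: nbhs_left_gt.
have lamC : mup - C^-1 < lam.
  by near: lam; apply: nbhs_left_gt; rewrite ltrBlDr ltrDl invr_gt0.
have lamI : mum < lam <= mup by rewrite mum_lam ltW.
have := angle_comparison lam_mup x00 (ode _ lamI) (ode _ mupI) (limit _ lamI)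
  (limit _ mupI) (trap _ lamI) (trap _ mupI) dpi _ SK.
move=> /(_ (fun x u xe => let: And3 _ _ h := fun_e x xe in h u)) cmp.
have small : 2 * (mup - lam) * expR ((`|K| + 1) * x0) < 1.
  rewrite mulrAC -/C -[ltRHS](mulfV (lt0r_neq0 C0)) ltr_pM2l //; lra.
have start : pi *+ k < theta x0 lam by lra.
have above := angle_above_natpi (ode _ lamI)
  (fun x xX => lt_trans (hX x xX) mum_lam) x00 x0X start.
apply: le_trans Ak _.
apply: (cvgr_to_ge (hnu _ _)); first by rewrite mum_lam.
by near=> x; apply/ltW/above; near: x; apply: nbhs_pinfty_ge; exact: num_real.
Unshelve. all: by end_near.
Qed.
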